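(* Let $K:\mathbb{R}\to\mathbb{R}$ be a continuous function that is not a polynomial, and let $$\mathcal{S}=\mathrm{span}\left\{\, x\mapsto K\!\left(\frac{x-c}{\sigma}\right) \;:\; c,\sigma\in\mathbb{R},\ \sigma\neq 0\right\}$$ (finite linear combinations of shifted and rescaled copies of $K$, viewed as functions $\mathbb{R}\to\mathbb{R}$). Let $d\ge 1$ be an integer. Then for every continuous $f:[0,1]^d\to\mathbb{R}$ and every $\varepsilon>0$ there exist functions $\widehat{\Phi}^{(q)}\in\mathcal{S}$ for $1\le q\le 2d+1$ and $\widehat{\phi}^{(pq)}\in\mathcal{S}$ for $1\le p\le d$, $1\le q\le 2d+1$, such that the function $$g(x_1,\dots,x_d)=\sum_{q=1}^{2d+1}\widehat{\Phi}^{(q)}\!\left(\sum_{p=1}^{d}\widehat{\phi}^{(pq)}(x_p)\right)$$ satisfies $$\sup_{(x_1,\dots,x_d)\in[0,1]^d}\bigl|f(x_1,\dots,x_d)-g(x_1,\dots,x_d)\bigr|<\varepsilon .$$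
   Context: A function of the displayed form $g$ (a sum over $q$ of outer univariate functions from $\mathcal{S}$ applied to sums over $p$ of inner univariate functions from $\mathcal{S}$ of single coordinates) is called a non-polynomial KAN (NP-KAN) network with kernel $K$. *)

(* Defs.v *)
From HB Require Import structures.
From mathcomp Require Import all_boot all_order all_algebra.
From mathcomp Require Import all_classical all_reals all_analysis.
Set Implicit Arguments. Unset Strict Implicit. Unset Printing Implicit Defensive.
Import Order.TTheory GRing.Theory Num.Theory.
Import numFieldNormedType.Exports.
Local Open Scope ring_scope.
Local Open Scope classical_set_scope.

Definition is_poly_fun (R : realType) (K : R -> R) : Prop :=
  exists P : {poly R}, forall x, K x = P.[x].

Definition in_span_K (R : realType) (K : R -> R) (h : R -> R) : Prop :=
  exists s : seq (R * R * R),
    (forall t, t \in s -> t.2 != 0) /\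
    forall x, h x = \sum_(t <- s) t.1.1 * K ((x - t.1.2) / t.2).

Definition unit_cube (R : realType) (d : nat) : set 'rV[R]_d :=
  [set x | forall i : 'I_d, 0 <= x ord0 i <= 1].

Definition npkan (R : realType) (d : nat)
  (Phi : 'I_(2 * d + 1) -> R -> R) (phi : 'I_d -> 'I_(2 * d + 1) -> R -> R)
  (x : 'rV[R]_d) : R :=
  \sum_(q < 2 * d + 1) Phi q (\sum_(p < d) phi p q (x ord0 p)).

(* Main.v *)
Require Import Defs.
From HB Require Import structures.
From mathcomp Require Import all_boot all_order all_algebra.
From mathcomp Require Import all_classical all_reals all_analysis.
From mathcomp Require Import ring lra zify.
Import Order.TTheory GRing.Theory Num.Theory.
Import numFieldNormedType.Exports.
Local Open Scope ring_scope.
Local Open Scope classical_set_scope.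

(** Two facts are combined.

    Density.  If [x ^+ m * k (w * x + b)] is locally uniformly approximable by
    the span of [K] for all [w] and [b], then averaging over [b] and
    differentiating in [w] shows the same for
    [x ^+ m.+1 * (k (w * x + b + h) - k (w * x + b))].  So if some monomial
    [x ^+ N] were not approximable, downward induction from [N] (where [w = 0]
    forces [k = 0]) would make [k = K] polynomial, because a continuous function
    all of whose differences are polynomial is polynomial.  Hence polynomials,
    then [x |-> `|x|], then all piecewise linear functions are approximable.

    Superposition.  Split the line into short cells separated by gaps, with
    [2d + 1] translated copies of this pattern such that every real lies in a gap
    of exactly one copy.  A point of the cube is then inside a product cell for at
    least [d + 1] copies.  Inner functions that are constant on cells, with sums
    that separate product cells, can be found near any given inner functions, and
    outer functions with values [f / (d + 1)] on cells leave an error of at most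
    about [d / (d + 1)] times the sup norm of [f].  Since the outer functions
    found so far are uniformly continuous, the inner functions may be perturbed
    slightly at each step, and the error decreases geometrically. *)

(** * Uniform continuity and primitives *)

(** Heine-Cantor: half a radius of continuity at a point serves all nearby points, and the
    near-covering form of compactness makes the choice uniform. *)
Lemma compact_unif_cont (R : realType) (T : pseudoMetricType R) (A : set T)
    (f : T -> R) : compact A -> {within A, continuous f} ->
  forall e : R, 0 < e -> exists2 delta : R, 0 < delta &
    forall x y, A x -> A y -> ball x delta y -> `|f x - f y| < e.
Proof.
move=> /compact_near_coveringP cA /subspace_continuousP cf e e0.
have H : forall x, A x -> \forall x' \near x & d \near 0^'+,
    A x' -> forall y, A y -> ball x' d y -> `|f x' - f y| < e.
  move=> x Ax.
  have e20 : 0 < e / 2 by rewrite divr_gt0.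
  have /cvgrPdist_lt /(_ _ e20) /nbhs_ballP[eta /= eta0 Heta] := cf x Ax.
  have eta20 : 0 < eta / 2 by rewrite divr_gt0.
  exists (ball x (eta / 2), [set d | d < eta / 2]).
    split; first exact: nbhsx_ballx.
    exact: nbhs_right_lt.
  move=> [x' d] /= [xx' dlt] Ax' y Ay x'y.
  have h1 : `|f x - f x'| < e / 2.
    apply: Heta => //; apply: le_ball xx'; lra.
  have h2 : `|f x - f y| < e / 2.
    apply: Heta => //; rewrite [eta]splitr; apply: ball_triangle xx' _.
    by apply: le_ball x'y; exact: ltW.
  rewrite (_ : f x' - f y = (f x - f y) - (f x - f x')); last by ring.
  by rewrite (le_lt_trans (ler_normB _ _))// [e]splitr ltrD.
have Hn := cA R (0^'+) _ (at_right_proper_filter 0) H.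
have [d [d0 Ad]] := filter_ex (filterI (nbhs_right_gt (0 : R)) Hn).
by exists d => // x y Ax Ay; exact: Ad.
Qed.

Lemma compact_norm_bounded (R : realType) (T : topologicalType) (A : set T)
    (f : T -> R) : compact A -> {within A, continuous f} ->
  exists2 B : R, 0 < B & forall x, A x -> `|f x| <= B.
Proof.
move=> cA cf; have /compact_bounded [M [_ HM]] := continuous_compact cf cA.
exists (`|M| + 1) => [|x Ax]; first by rewrite ltr_wpDl.
by apply: HM; [rewrite (le_lt_trans (ler_norm M))// ltrDl|exists x].
Qed.

Section RealLine.
Variable R : realType.
Implicit Types (k : R -> R).

Lemma unif_cont_bounded k : continuous k ->
  forall B e : R, 0 < e -> exists2 delta : R, 0 < delta &
    forall x y, `|x| <= B -> `|y| <= B -> `|x - y| < delta -> `|k x - k y| < e.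
Proof.
move=> ck B e e0.
have cw : {within `[- B, B], continuous k} by apply: continuous_subspaceT.
have [delta d0 H] := @compact_unif_cont R R _ _ (@segment_compact _ _ _) cw e e0.
exists delta => // x y xB yB xy; apply: H => //=; rewrite in_itv/= -ler_norml//.
Qed.

Lemma bounded_on_ball k : continuous k ->
  forall B : R, exists2 C : R, 0 < C & forall x, `|x| <= B -> `|k x| <= C.
Proof.
move=> ck B.
have cw : {within `[- B, B], continuous k} by apply: continuous_subspaceT.
have [C C0 H] := compact_norm_bounded _ _ _ _ (@segment_compact _ _ _) cw.
by exists C => // x xB; apply: H => /=; rewrite in_itv/= -ler_norml.
Qed.

Lemma local_primitive k (B : R) : continuous k ->
  exists G : R -> R, forall x : R, `|x| < B -> is_derive x (1 : R) G (k x).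
Proof.
move=> ck.
pose G (x : R) := (\int[lebesgue_measure]_(t in [set` Interval (BLeft (- B)) (BRight x)]) k t)%R.
exists G => x; rewrite ltr_norml => /andP[Bx xB].
have [] := @continuous_FTC1 R k (BLeft (- B)) x B xB _ _ (ck x).
- apply: continuous_compact_integrable; first exact: segment_compact.
  exact: continuous_subspaceT.
- by rewrite lte_fin.
by rewrite derive1E => ? <-; exact: DeriveDef.
Qed.

(** The mean value theorem turns an increment of [G] into a value of [k] at an intermediate point,
    so the modulus of uniform continuity of [k] serves all base points. Used for Riemann sums and
    for difference quotients. *)
Lemma unif_primitive k (B : R) : continuous k ->
  exists G : R -> R, forall e : R, 0 < e -> exists2 delta : R, 0 < delta &
    forall x y, `|x| <= B -> `|y| <= B -> `|y - x| < delta ->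
    `|G y - G x - k x * (y - x)| <= e * `|y - x|.
Proof.
move=> ck; have [G dG] := local_primitive k (B + 1) ck.
exists G => e e0; have [delta d0 H] := unif_cont_bounded k ck B e e0.
have main : forall a b, a <= b -> `|a| <= B -> `|b| <= B -> b - a < delta ->
    exists2 c, a <= c <= b & G b - G a = k c * (b - a).
  move=> a b ab aB bB bad.
  have inB : forall z, a <= z <= b -> `|z| < B + 1.
    move=> z /andP[az zb]; move: aB bB; rewrite ltr_norml !ler_norml.
    by move=> /andP[? ?] /andP[? ?]; apply/andP; split; lra.
  have [|||c] := @MVT_segment R G k a b; last 1 first.
  - by rewrite in_itv/= => cab ->; exists c.
  - by [].
  - by move=> z; rewrite in_itv/= => /andP[/ltW ? /ltW ?]; apply/dG/inB/andP.
  - apply: derivable_within_continuous => z; rewrite in_itv/= => zab.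
    by have := dG z (inB z zab) => -[].
exists delta => // x y xB yB xy.
have [c cx ->] : exists2 c, `|c - x| < delta /\ `|c| <= B & G y - G x = k c * (y - x).
  have [le_xy|lt_yx] := leP x y.
    have [||//|c /andP[xc cy] Hc] := main x y le_xy => //.
      by rewrite (le_lt_trans (ler_norm _)).
    exists c => //; split.
      rewrite ger0_norm ?subr_ge0//; move: xy; rewrite ger0_norm ?subr_ge0//; lra.
    move: xB yB; rewrite !ler_norml => /andP[? ?] /andP[? ?]; apply/andP; split; lra.
  have [||//|c /andP[xc cy] Hc] := main y x (ltW lt_yx) => //.
    by move: xy; rewrite ltr_norml => /andP[? ?]; lra.
  exists c; last by rewrite -opprB Hc; ring.
  split.
    by move: xy; rewrite !ltr_norml => /andP[? ?]; apply/andP; split; lra.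
  move: xB yB; rewrite !ler_norml => /andP[? ?] /andP[? ?]; apply/andP; split; lra.
rewrite -mulrBl normrM ler_wpM2r// ltW// H//; tauto.
Qed.

End RealLine.

(** * Functions with polynomial differences *)

Section Differences.
Variable R : realType.
Implicit Types (k : R -> R) (P Q : {poly R}).

Definition has_antidifference (u : R -> R) :=
  exists Q, forall x, Q.[x + 1] - Q.[x] = u x.

Lemma has_antidifferenceZ c u :
  has_antidifference u -> has_antidifference (fun x => c * u x).
Proof.
by move=> [Q HQ]; exists (c *: Q) => x; rewrite !hornerZ -HQ; ring.
Qed.

Lemma has_antidifferenceD u v : has_antidifference u ->
  has_antidifference v -> has_antidifference (fun x => u x + v x).
Proof.
move=> [P HP] [Q HQ]; exists (P + Q) => x.
by rewrite !hornerD -HQ -HP; ring.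
Qed.

Lemma has_antidifference_sum n (F : nat -> R -> R) :
  (forall i, (i < n)%N -> has_antidifference (F i)) ->
  has_antidifference (fun x => \sum_(i < n) F i x).
Proof.
elim: n => [|n IH] HF.
  by exists 0 => x; rewrite !horner0 big_ord0 subrr.
have [Q HQ] := has_antidifferenceD _ _
  (IH (fun i lin => HF i (ltnW lin))) (HF n (ltnSn n)).
by exists Q => x; rewrite HQ big_ord_recr.
Qed.

(** The unit difference of [x ^+ n.+1] is [n.+1 * x ^+ n] plus lower powers, whose antidifferences
    are given by induction. *)
Lemma has_antidifferenceX n : has_antidifference (fun x => x ^+ n).
Proof.
elim/ltn_ind: n => n IH.
have [Q HQ] := has_antidifference_sum n
  (fun i x => (- 'C(n.+1, i)%:R) * x ^+ i)
  (fun i lin => has_antidifferenceZ _ _ (IH i lin)).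
exists (n.+1%:R^-1 *: ('X^(n.+1) + Q)) => x.
rewrite !hornerZ !hornerD !hornerXn -mulrBr.
rewrite (_ : _ - _ = ((x + 1) ^+ n.+1 - x ^+ n.+1) + (Q.[x + 1] - Q.[x])); last by ring.
rewrite HQ addrC (addrC x 1) exprDn !big_ord_recr/=.
rewrite subnn expr0 binn mulr1n mul1r addrK subSnn expr1n mul1r binSn.
rewrite addrA -big_split/= big1 => [|i _].
  by rewrite add0r -[x ^+ n *+ _]mulr_natl mulrA mulVf ?mul1r// pnatr_eq0.

by rewrite expr1n mul1r -[x ^+ i *+ _]mulr_natl mulNr addNr.
Qed.

Lemma has_antidifference_horner P : has_antidifference (fun x => P.[x]).
Proof.
have [Q HQ] := has_antidifference_sum (size P) (fun i x => P`_i * x ^+ i)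
  (fun i _ => has_antidifferenceZ _ _ (has_antidifferenceX i)).
by exists Q => x; rewrite HQ horner_coef.
Qed.

(** [P - P.[0]] vanishes at every natural number, so it has too many roots. *)
Lemma periodic_poly_const P : (forall x, P.[x + 1] = P.[x]) ->
  forall x, P.[x] = P.[0].
Proof.
move=> per; pose Q := P - P.[0]%:P.
have rootQ (n : nat) : root Q n%:R.
  rewrite /root hornerD hornerN hornerC subr_eq0; apply/eqP.
  by elim: n => // n <-; rewrite -natr1 per.
suff Q0 : Q = 0.
  by move=> x; apply/eqP; rewrite -subr_eq0 -(hornerC P.[0] x) -hornerN -hornerD -/Q Q0 horner0.
apply/eqP/negPn/negP => /max_poly_roots H.
have := H [seq i%:R | i <- iota 0 (size Q)].
rewrite size_map size_iota ltnn => /(_ _ _)/negP[]//.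
- by apply/allP => _ /mapP[i _ ->].
- by rewrite map_inj_uniq ?iota_uniq//; exact: mulrIn (oner_neq0 R).
Qed.

(** Subtracting a polynomial [Q] with the same unit difference leaves a continuous 1-periodic [E],
    hence a bounded one. Its difference by any [h] is a periodic polynomial, so a constant, and
    boundedness along the multiples of [h] makes that constant zero. *)
Lemma poly_of_differences k : continuous k ->
  (forall h, is_poly_fun (fun x => k (x + h) - k x)) -> is_poly_fun k.
Proof.
move=> ck Hk; have [P1 HP1] := Hk 1.
have [Q HQ] := has_antidifference_horner P1.
pose E x := k x - Q.[x].
have E1 x : E (x + 1) = E x.
  by apply/eqP; rewrite /E -subr_eq0; apply/eqP; move: (HP1 x) (HQ x); lra.
have En (n : nat) x : E (x + n%:R) = E x.
  by elim: n => [|n IH]; rewrite ?addr0// -natr1 addrA E1.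
have cE : continuous E.
  by move=> x; apply: cvgB; [exact: ck|exact: continuous_horner].
have [C C0 HC] := bounded_on_ball _ E cE 1.
have Ez (z : int) x : E (x + z%:~R) = E x.
  case: z => n; first exact: En.
  by rewrite NegzE mulrNz -[LHS](En n.+1) -addrA addNr addr0.
have EB x : `|E x| <= C.
  rewrite -(Ez (- Num.floor x)) HC// mulrNz ger0_norm ?subr_ge0 ?floor_le//.
  by have := floorD1_gt x; rewrite intrD; lra.
have Ec h : E h = E 0.
  have [P HP] := Hk h.
  pose D := P - (Q \Po ('X + h%:P) - Q).
  have HD x : D.[x] = E (x + h) - E x.
    rewrite /D !(hornerD, hornerN) horner_comp !(hornerD, hornerX, hornerC) -HP /E; ring.
  have Dc x : E (x + h) - E x = D.[0].
    by rewrite -HD; apply: periodic_poly_const => {}x; rewrite !HD (addrAC x 1 h) !E1.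
  set c := D.[0] in Dc.
  have Enh (n : nat) : E (n%:R * h) = E 0 + n%:R * c.
    elim: n => [|n IH]; first by rewrite !mul0r addr0.
    rewrite -natr1 mulrDl mul1r; have := Dc (n%:R * h); rewrite IH; lra.
  have c0 : c = 0.
    apply/eqP/negPn/negP => c_neq0.
    have cp : 0 < `|c| by rewrite normr_gt0.
    pose n := Num.bound (2 * C / `|c|).
    have : 2 * C / `|c| < n%:R by apply: archi_boundP; rewrite divr_ge0// mulr_ge0// ltW.
    rewrite ltr_pdivrMr// ltNge => /negP; apply.
    rewrite (_ : n%:R * `|c| = `|E (n%:R * h) - E 0|); last first.
      by rewrite Enh addrAC subrr add0r normrM ger0_norm.
    by rewrite (le_trans (ler_normB _ _))// (_ : 2 * C = C + C) ?lerD//; ring.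
  by have := Dc 0; rewrite add0r c0 => /eqP; rewrite subr_eq0 => /eqP.
exists (Q + (E 0)%:P) => x; rewrite hornerD hornerC -(Ec x) /E; ring.
Qed.

End Differences.

(** * Approximation by the span of the kernel *)

Section Approximation.
Variables (R : realType) (K : R -> R).
Implicit Types (u v k : R -> R) (r e : R).

Lemma in_span0 : in_span_K K (fun=> 0).
Proof. by exists [::]; split=> // x; rewrite big_nil. Qed.

Lemma in_spanD u v : in_span_K K u -> in_span_K K v ->
  in_span_K K (fun x => u x + v x).
Proof.
move=> [s [s0 Hs]] [t [t0 Ht]]; exists (s ++ t); split=> [z|x].
  by rewrite mem_cat => /orP[/s0|/t0].
by rewrite big_cat/= Hs Ht.
Qed.

Lemma in_spanZ c u : in_span_K K u -> in_span_K K (fun x => c * u x).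
Proof.
move=> [s [s0 Hs]]; exists [seq ((c * z.1.1, z.1.2), z.2) | z <- s].
split=> [z /mapP[y /s0 y0 ->]//|x].
by rewrite big_map Hs mulr_sumr; apply: eq_bigr => z _; rewrite mulrA.
Qed.

Lemma in_span_affine u a b : a != 0 -> in_span_K K u ->
  in_span_K K (fun x => u (a * x + b)).
Proof.
move=> a0 [s [s0 Hs]].
exists [seq ((z.1.1, (z.1.2 - b) / a), z.2 / a) | z <- s]; split.
  by move=> _ /mapP[y /s0 y0 ->]/=; rewrite mulf_neq0// invr_eq0.
move=> x; rewrite big_map Hs; apply: eq_big_seq => z /s0 z0 /=.
by congr (_ * K _); field; rewrite a0 z0.
Qed.

Lemma in_span_self : in_span_K K K.
Proof.
exists [:: ((1, 0), 1)]; split=> [z|x].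
  by rewrite inE => /eqP->/=; rewrite oner_neq0.
by rewrite big_seq1/= mul1r subr0 divr1.
Qed.

Definition approx_on r u := forall e, 0 < e ->
  exists s, in_span_K K s /\ forall x, `|x| <= r -> `|u x - s x| <= e.

Lemma approx_on_span r u : in_span_K K u -> approx_on r u.
Proof. by move=> su e e0; exists u; split=> // x _; rewrite subrr normr0 ltW. Qed.

Lemma approx_on_lim r u :
  (forall e, 0 < e -> exists2 v, approx_on r v &
    forall x, `|x| <= r -> `|u x - v x| <= e) -> approx_on r u.
Proof.
move=> H e e0; have e20 : 0 < e / 2 by rewrite divr_gt0.
have [v av uv] := H _ e20; have [s [ss vs]] := av _ e20.
exists s; split=> // x xr; rewrite (_ : u x - s x = (u x - v x) + (v x - s x)); last by ring.
by rewrite (le_trans (ler_normD _ _))// [leRHS]splitr lerD ?uv ?vs.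
Qed.

Lemma approx_on_ext r u v : (forall x, u x = v x) -> approx_on r u -> approx_on r v.
Proof.
by move=> uv au; apply: approx_on_lim => e e0; exists u => // x _; rewrite uv subrr normr0 ltW.
Qed.

Lemma approx_onD r u v : approx_on r u -> approx_on r v ->
  approx_on r (fun x => u x + v x).
Proof.
move=> au av e e0; have e20 : 0 < e / 2 by rewrite divr_gt0.
have [s [ss us]] := au _ e20; have [t [st vt]] := av _ e20.
exists (fun x => s x + t x); split=> [|x xr]; first exact: in_spanD.
rewrite (_ : _ - _ = (u x - s x) + (v x - t x)); last by ring.
by rewrite (le_trans (ler_normD _ _))// [leRHS]splitr lerD ?us ?vt.
Qed.

Lemma approx_onZ r c u : approx_on r u -> approx_on r (fun x => c * u x).
Proof.
move=> au e e0; have c0 : 0 < `|c| + 1 by rewrite ltr_wpDl.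
have [|s [ss us]] := au (e / (`|c| + 1)); first by rewrite divr_gt0.
exists (fun x => c * s x); split=> [|x xr]; first exact: in_spanZ.
rewrite -mulrBr normrM (le_trans (ler_wpM2l _ (us _ xr)))//.
by rewrite mulrCA ler_piMr ?(ltW e0)// ler_pdivrMr// mul1r lerDl.
Qed.

Lemma approx_on_sum r n (F : nat -> R -> R) : (forall i, approx_on r (F i)) ->
  approx_on r (fun x => \sum_(i < n) F i x).
Proof.
move=> HF; elim: n => [|n IH].
  by apply: approx_on_ext (approx_on_span _ _ in_span0) => x; rewrite big_ord0.
by apply: approx_on_ext (approx_onD _ _ _ IH (HF n)) => x; rewrite big_ord_recr.
Qed.

Hypothesis cK : continuous K.

(** For [w = 0] the constant [K b] is reached as the limit of [K (a * x + b)] when the nonzero slope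
    [a] tends to 0. *)
Lemma approx_on_kernel r w b : 0 < r -> approx_on r (fun x => K (w * x + b)).
Proof.
move=> r0; have [->|w0] := eqVneq w 0; last first.
  exact/approx_on_span/in_span_affine/in_span_self.
apply: approx_on_lim => e e0.
have [delta d0 Hd] := unif_cont_bounded _ _ cK (`|b| + r) e e0.
pose a := Num.min 1 (delta / (r * 2)).
have r20 : 0 < r * 2 by rewrite mulr_gt0.
have a0 : 0 < a by rewrite lt_min ltr01 divr_gt0.
have a1 : a <= 1 by rewrite ge_min lexx.
have ar : a * r < delta.
  have : a <= delta / (r * 2) by rewrite ge_min lexx orbT.
  rewrite ler_pdivlMr//; nra.
exists (fun x => K (a * x + b)) => [|x xr].
  by apply/approx_on_span/in_span_affine/in_span_self; rewrite gt_eqF.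
have axr : `|a * x| <= a * r by rewrite normrM gtr0_norm// ler_wpM2l// ltW.
rewrite mul0r add0r ltW// Hd//.
- by rewrite lerDl ltW.
- rewrite addrC (le_trans (ler_normD _ _))// lerD2l (le_trans axr)//.
  by rewrite ler_piMl// ltW.
by rewrite opprD addrCA subrr addr0 normrN (le_lt_trans axr).
Qed.

Lemma norm_affine_le r w (x b : R) : `|x| <= r -> `|w * x + b| <= `|w| * r + `|b|.
Proof.
move=> xr; rewrite (le_trans (ler_normD _ _))// lerD2r normrM.
by rewrite ler_wpM2l.
Qed.

(* Averaging the shift [b] over an interval of length [h] replaces [k] by a
   primitive difference, and differentiating in the dilation [w] then brings
   out one more factor [x]. *)
Lemma approx_on_difference r m k : 0 < r -> continuous k ->
  (forall w b, approx_on r (fun x => x ^+ m * k (w * x + b))) ->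
  forall h w b, approx_on r (fun x => x ^+ m.+1 * (k (w * x + b + h) - k (w * x + b))).
Proof.
move=> r0 ck Hk h w b.
(* Bounds every argument met below; the [+ 1] leaves room for moving the dilation from [w] to
   [w + a] with [a <= 1]. *)
pose B := (`|w| + 1) * r + (`|b| + `|h|).
have [G HG] := unif_primitive _ k B ck.
have inB w' c x : `|w'| <= `|w| + 1 -> `|c| <= `|b| + `|h| -> `|x| <= r ->
    `|w' * x + c| <= B.
  move=> w'w cb xr; rewrite (le_trans (norm_affine_le r _ _ _ xr))// lerD//.
  by rewrite ler_pM2r.
have inb t : 0 <= t <= 1 -> `|b + t * h| <= `|b| + `|h|.
  move=> /andP[t0 t1]; rewrite (le_trans (ler_normD _ _))// lerD2l normrM ger0_norm//.
  by rewrite ler_piMl.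
have xm x n : `|x| <= r -> `|x ^+ n| <= r ^+ n.
  by move=> xr; rewrite normrX lerXn2r// ?nnegrE// ltW.
(* Riemann sums of [k] over the shifts between [b] and [b + h] converge to the increment of [G],
   uniformly in [x], and each summand is approximable. *)
have avg w' : `|w'| <= `|w| + 1 ->
    approx_on r (fun x => x ^+ m * (G (w' * x + b + h) - G (w' * x + b))).
  move=> w'w; apply: approx_on_lim => e e0.
  have C0 : 0 < r ^+ m * (`|h| + 1) by rewrite mulr_gt0 ?exprn_gt0// ltr_wpDl.
  have [|delta d0 Hd] := HG (e / (r ^+ m * (`|h| + 1))); first by rewrite divr_gt0.
  pose n := (Num.bound (`|h| / delta)).+1.
  have n0 : 0 < n%:R :> R by rewrite ltr0n.
  have hn : `|h / n%:R| < delta.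
    rewrite normrM normfV (ger0_norm (ltW n0)) ltr_pdivrMr// -ltr_pdivrMl// mulrC.
    have : `|h| / delta < (Num.bound (`|h| / delta))%:R.
      by apply: archi_boundP; rewrite divr_ge0// ltW.
    by move=> /lt_le_trans; apply; rewrite ler_nat.
  pose F (i : nat) x := h / n%:R * (x ^+ m * k (w' * x + (b + i%:R / n%:R * h))).
  exists (fun x => \sum_(i < n) F i x).
    by apply: (approx_on_sum r n F) => i; exact: approx_onZ.
  move=> x xr.
  pose y (i : nat) := w' * x + (b + i%:R / n%:R * h).
  have yB i : (i <= n)%N -> `|y i| <= B.
    move=> lin; apply: inB => //; apply: inb.
    by rewrite divr_ge0//= ler_pdivrMr// mul1r ler_nat.
  have yS i : y i.+1 - y i = h / n%:R.
    by rewrite /y -natr1; field; rewrite gt_eqF.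
  have -> : G (w' * x + b + h) - G (w' * x + b) = \sum_(i < n) (G (y i.+1) - G (y i)).
    rewrite -(big_mkord xpredT (fun i => G (y i.+1) - G (y i))) telescope_sumr//.
    by congr (G _ - G _); rewrite /y; field; rewrite gt_eqF.
  rewrite mulr_sumr -sumrB (le_trans (ler_norm_sum _ _ _))//.
  apply: (@le_trans _ _ (\sum_(i < n) e / n%:R)); last first.
    by rewrite sumr_const card_ord -(mulr_natr (e / n%:R)) divfK// gt_eqF.
  apply: ler_sum => i _.
  rewrite /F -/(y i) mulrCA -mulrBr normrM.
  have Hi : `|G (y i.+1) - G (y i) - k (y i) * (h / n%:R)| <=
      e / (r ^+ m * (`|h| + 1)) * `|h / n%:R|.
    rewrite -(yS i); apply: Hd; rewrite ?yS//; apply: yB => //.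
    exact: ltnW.
  rewrite [h / _ * _]mulrC (le_trans (ler_pM _ _ (xm _ _ xr) Hi))//.
  rewrite normrM normfV (ger0_norm (ltW n0)).
  rewrite [leLHS](_ : _ = e / n%:R * (`|h| / (`|h| + 1))); last first.
    by field; rewrite !gt_eqF ?exprn_gt0// ltr_wpDl.
  rewrite ler_piMr//; first by rewrite divr_ge0 ?ltW.
  by rewrite ler_pdivrMr ?mul1r ?lerDl// ltr_wpDl.
apply: approx_on_lim => e e0.
have C0 : 0 < 2 * r ^+ m.+1 by rewrite mulr_gt0// exprn_gt0.
have [|delta d0 Hd] := HG (e / (2 * r ^+ m.+1)); first by rewrite divr_gt0.
have r20 : 0 < r * 2 by rewrite mulr_gt0.
pose a := Num.min 1 (delta / (r * 2)).
have a0 : 0 < a by rewrite lt_min ltr01 divr_gt0.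
have a1 : a <= 1 by rewrite ge_min lexx.
have ar : a * r < delta.
  have : a <= delta / (r * 2) by rewrite ge_min lexx orbT.
  rewrite ler_pdivlMr//; nra.
have wa : `|w + a| <= `|w| + 1.
  by rewrite (le_trans (ler_normD _ _))// lerD2l gtr0_norm.
(* The difference quotient of [W] at [w] with increment [a]: the derivative of [G (w * x + c)] in
   [w] is [x * k (w * x + c)]. *)
pose W w' x := x ^+ m * (G (w' * x + b + h) - G (w' * x + b)).
exists (fun x => a^-1 * W (w + a) x + (- a^-1) * W w x) => [|x xr].
  by apply: approx_onD; apply: approx_onZ; apply: avg; rewrite // lerDl.
have axr : `|a * x| <= a * r by rewrite normrM gtr0_norm// ler_wpM2l// ltW.
have Hc c : `|c| <= `|b| + `|h| ->
    `|G ((w + a) * x + c) - G (w * x + c) - k (w * x + c) * (a * x)| <=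
    e / (2 * r ^+ m.+1) * (a * r).
  move=> cb; have E : a * x = ((w + a) * x + c) - (w * x + c) by ring.
  apply: (@le_trans _ _ (e / (2 * r ^+ m.+1) * `|a * x|)); last first.
    by rewrite ler_wpM2l// divr_ge0 ?ltW.
  rewrite E; apply: Hd; rewrite -?E ?(le_lt_trans axr)//; apply: inB => //.
  by rewrite lerDl.
have Hbh := Hc (b + h) (ler_normD _ _).
have Hb := Hc b; rewrite lerDl in Hb; have {}Hb := Hb (normr_ge0 _).
rewrite (_ : _ - _ = - (a^-1 * (x ^+ m *
   ((G ((w + a) * x + (b + h)) - G (w * x + (b + h)) - k (w * x + (b + h)) * (a * x))
  - (G ((w + a) * x + b) - G (w * x + b) - k (w * x + b) * (a * x)))))); last first.
  by rewrite /W exprS !addrA; field; rewrite gt_eqF.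
rewrite normrN normrM normfV (gtr0_norm a0) ler_pdivrMl// normrM.
have Hs := le_trans (ler_normB _ _) (lerD Hbh Hb).
rewrite (le_trans (ler_pM _ _ (xm _ m xr) Hs))//.
rewrite le_eqVlt; apply/orP; left; apply/eqP.
by rewrite exprS; field; rewrite !gt_eqF ?exprn_gt0.
Qed.

Hypothesis nK : ~ is_poly_fun K.

Lemma approx_on_monomial r N : 0 < r -> approx_on r (fun x => x ^+ N).
Proof.
move=> r0; apply: contrapT => notN.
(* Each difference raises the power by one, up to [x ^+ N] at [j = 0]. There [w = 0] gives
   [x ^+ N * k b], so a nonzero [k b] would make [x ^+ N] approximable. *)
have H j k : (j <= N)%N -> continuous k ->
    (forall w b, approx_on r (fun x => x ^+ (N - j) * k (w * x + b))) -> is_poly_fun k.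
  elim: j k => [|j IH] k jN ck Hk.
    exists 0 => b; rewrite horner0; apply: contrapT => /eqP kb0; apply: notN.
    apply: approx_on_ext (approx_onZ _ (k b)^-1 _ (Hk 0 b)) => x.
    by rewrite subn0 mul0r add0r; field.
  apply: poly_of_differences => // h; apply: IH; first exact: ltnW.
    move=> x; apply: cvgB; last exact: ck.
    by apply: (@continuous_comp _ _ _ (+%R^~ h) k); [exact: cvgD (cvg_cst _)|exact: ck].
  move=> w b; have := approx_on_difference r (N - j.+1) k r0 ck Hk h w b.
  by rewrite subnSK.
by apply: nK; apply: (H N) => // w b; rewrite subnn;
  apply: approx_on_ext (approx_on_kernel r w b r0) => x; rewrite expr0 mul1r.
Qed.

End Approximation.

(** * Piecewise linear functions *)

Section Staircase.
Variable R : realType.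
Implicit Types (x y t : R) (M j k : nat).

(** Written with absolute values so that its approximability reduces to theirs. *)
Definition clamp01 (t : R) : R := (`|t| - `|t - 1| + 1) / 2.

Lemma clamp01_le0 t : t <= 0 -> clamp01 t = 0.
Proof. by move=> t0; rewrite /clamp01 !ler0_norm; lra. Qed.

Lemma clamp01_ge1 t : 1 <= t -> clamp01 t = 1.
Proof. by move=> t1; rewrite /clamp01 !ger0_norm; lra. Qed.

Lemma clamp01_id t : 0 <= t <= 1 -> clamp01 t = t.
Proof. by move=> /andP[t0 t1]; rewrite /clamp01 ger0_norm ?ler0_norm//; lra. Qed.

Lemma clamp01_itv t : 0 <= clamp01 t <= 1.
Proof.
have [t0|t0] := leP t 0; first by rewrite clamp01_le0// lexx ler01.
have [t1|t1] := leP 1 t; first by rewrite clamp01_ge1// lexx ler01.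
by rewrite clamp01_id !ltW.
Qed.

Lemma clamp01_dist x t : 0 <= x <= 1 -> `|x - clamp01 t| <= `|x - t|.
Proof.
move=> /andP[x0 x1]; have [t0|t0] := leP t 0.
  by rewrite clamp01_le0// !ger0_norm; lra.
have [t1|t1] := leP 1 t; first by rewrite clamp01_ge1// !ler0_norm; lra.
by rewrite clamp01_id// !ltW.
Qed.

(* Interpolates [v 0], ..., [v M]: it climbs from [v i] to [v i.+1] on
   [i, i + w] and equals [v i.+1] on [i + w, i + 1]. *)
Fixpoint staircase (v : nat -> R) (w : R) (M : nat) (y : R) : R :=
  if M is M'.+1 then
    staircase v w M' y + (v M'.+1 - v M') * clamp01 ((y - M'%:R) / w)
  else v 0%N.

Variables (v : nat -> R) (w : R).
Hypotheses (w0 : 0 < w) (w1 : w <= 1).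

Lemma staircase_end M y : M%:R <= y -> staircase v w M y = v M.
Proof.
elim: M => [//|M IH] My /=; have My' : M%:R <= y.
  by apply: le_trans My; rewrite ler_nat.
rewrite IH// clamp01_ge1; first by ring.
by rewrite ler_pdivlMr// mul1r; move: My w1; rewrite -natr1; lra.
Qed.

Lemma staircaseE M j y : (j < M)%N -> j%:R <= y <= j.+1%:R ->
  staircase v w M y = v j + (v j.+1 - v j) * clamp01 ((y - j%:R) / w).
Proof.
elim: M => [//|M IH]; rewrite ltnS leq_eqVlt => /predU1P[->|jM] /andP[jy yj] /=.
  by rewrite staircase_end.
rewrite IH//; last by rewrite jy.
rewrite [X in _ + X](_ : _ = 0) ?addr0// clamp01_le0 ?mulr0//.
rewrite pmulr_lle0 ?invr_gt0// subr_le0 (le_trans yj)//.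
by rewrite ler_nat.
Qed.

Lemma staircase_cell M j y : (j < M)%N -> j%:R + w <= y <= j.+1%:R ->
  staircase v w M y = v j.+1.
Proof.
move=> jM /andP[jy yj]; rewrite (staircaseE M j)//; last first.
  by move: w0 => ?; apply/andP; split; lra.
rewrite clamp01_ge1; first by ring.
by rewrite ler_pdivlMr// mul1r; lra.
Qed.

Lemma staircase_nat M k : (k <= M)%N -> staircase v w M k%:R = v k.
Proof.
rewrite leq_eqVlt => /predU1P[->|kM]; first by rewrite staircase_end.
rewrite (staircaseE M k)//; last by rewrite lexx ler_nat leqnSn.
by rewrite subrr mul0r clamp01_le0// mulr0 addr0.
Qed.

(** Lets bounds on the nodes pass to every real argument, including those outside the range of the
    nodes. *)
Lemma staircase_segment M y : exists j t, 0 <= t <= 1 /\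
  staircase v w M y = v j + (v j.+1 - v j) * t.
Proof.
elim: M => [|M IH]; first by exists 0%N, 0; rewrite lexx ler01 mulr0 addr0.
have [My|yM] := leP M%:R y; last first.
  by rewrite /= clamp01_le0 ?mulr0 ?addr0// pmulr_lle0 ?invr_gt0// subr_le0 ltW.
exists M, (clamp01 ((y - M%:R) / w)); rewrite clamp01_itv/=.
by rewrite staircase_end.
Qed.

End Staircase.

(** * Approximability of the absolute value and of piecewise linear functions *)

Section Approximable.
Variables (R : realType) (K : R -> R).
Hypothesis cK : continuous K.
Hypothesis nK : ~ is_poly_fun K.
Implicit Types (u v : R -> R) (a b c r e x : R).

(** All radii are required because the range of the inner sums is not known in advance; continuity
    is what allows networks to be perturbed. *)
Definition approximable u := continuous u /\ forall r, 0 < r -> approx_on _ K r u.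

Lemma approximableD u v : approximable u -> approximable v ->
  approximable (fun x => u x + v x).
Proof.
move=> [cu au] [cv av]; split=> [x|r r0].
  by apply: cvgD; [exact: cu|exact: cv].
by apply: approx_onD; [exact: au|exact: av].
Qed.

Lemma approximableZ c u : approximable u -> approximable (fun x => c * u x).
Proof.
move=> [cu au]; split=> [x|r r0]; last exact/approx_onZ/au.
by apply: cvgM; [exact: cvg_cst|exact: cu].
Qed.

Lemma approximable_cst c : approximable (fun=> c).
Proof.
split=> [x|r r0]; first exact: cvg_cst.
apply: approx_on_ext (approx_onZ _ _ _ c _ (approx_on_monomial _ _ cK nK r 0 r0)) => x.
by rewrite expr0 mulr1.
Qed.

Lemma approximable_affine u a b : a != 0 -> approximable u ->
  approximable (fun x => u (a * x + b)).
Proof.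
move=> a0 [cu au]; split=> [x|r r0 e e0].
  apply: (@continuous_comp _ _ _ (fun x => a * x + b) u); last exact: cu.
  by apply: cvgD; [apply: cvgM; [exact: cvg_cst|exact: cvg_id]|exact: cvg_cst].
have r'0 : 0 < `|a| * r + `|b| by rewrite ltr_wpDr// mulr_gt0// normr_gt0.
have [s [ss us]] := au _ r'0 e e0.
exists (fun x => s (a * x + b)); split; first exact: in_span_affine.
by move=> x xr; apply: us; exact: norm_affine_le.
Qed.

(** The classical iteration from 0 that increases to the absolute value on [[-1, 1]]. *)
Fixpoint abs_poly (n : nat) : {poly R} :=
  if n is n'.+1 then
    abs_poly n' + 2^-1 *: ('X ^+ 2 - abs_poly n' ^+ 2)
  else 0.

(** With [t] for the absolute value of [x], one step multiplies the error by [1 - (t + p) / 2], at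
    most [1 - t / 2], and [(1 - t / 2) * (1 + (n + 1) * (t / 2)) <= 1 + n * (t / 2)] preserves the
    invariant. *)
Lemma abs_polyP n x : `|x| <= 1 ->
  0 <= (abs_poly n).[x] <= `|x| /\
  (`|x| - (abs_poly n).[x]) * (1 + n%:R * (`|x| / 2)) <= `|x|.
Proof.
move=> x1; have x2 : x ^+ 2 = `|x| ^+ 2 by rewrite real_normK ?num_real.
elim: n => [|n [/andP[p0 px] IH]] /=.
  by rewrite horner0 normr_ge0 lexx subr0 mul0r addr0 mulr1.
rewrite hornerD hornerZ hornerD hornerN !horner_exp hornerX x2.
have t0 := normr_ge0 x.
have n0 : 0 <= n%:R :> R by [].
rewrite -[n.+1%:R]natr1.
move: (`|x|) (abs_poly n).[x] n%:R t0 x1 p0 px IH n0 => t p m t0 t1 p0 pt IH m0.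
have E : t - (p + 2^-1 * (t ^+ 2 - p ^+ 2)) = (t - p) * (1 - (t + p) / 2) by field.
split.
  apply/andP; split; last by rewrite -subr_ge0 E mulr_ge0//; lra.
  by rewrite addr_ge0// mulr_ge0 ?invr_ge0// subr_ge0 lerXn2r.
rewrite E.
apply: le_trans IH; rewrite -mulrA ler_wpM2l ?subr_ge0//.
apply: (@le_trans _ _ ((1 - t / 2) * (1 + (m + 1) * (t / 2)))).
  by rewrite ler_wpM2r//; nra.
nra.
Qed.

Lemma approximable_poly (P : {poly R}) : approximable (fun x => P.[x]).
Proof.
split; first exact: continuous_horner.
move=> r r0; apply: (approx_on_ext _ _ _ (fun x => \sum_(i < size P) P`_i * x ^+ i)).
  by move=> x; rewrite horner_coef.
apply: (approx_on_sum _ _ r (size P) (fun i x => P`_i * x ^+ i)) => i.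
by apply: approx_onZ; exact: approx_on_monomial.
Qed.

Lemma approximable_norm : approximable (fun x => `|x|).
Proof.
split; first exact: norm_continuous.
move=> r r0; apply: approx_on_lim => e e0.
pose n := (Num.bound (2 * r / e)).+1.
have n0 : 0 < n%:R :> R by rewrite ltr0n.
have ne : 2 * r / e < n%:R.
  have : 2 * r / e < (Num.bound (2 * r / e))%:R.
    by apply: archi_boundP; rewrite divr_ge0 ?ltW// mulr_gt0.
  by move=> /lt_le_trans; apply; rewrite ler_nat.
exists (fun x => r * (abs_poly n).[r^-1 * x + 0]) => [|x xr].
  apply: approx_onZ; apply: (approximable_affine (horner (abs_poly n)) _ _ _ _).2 => //.
    by rewrite invr_neq0// gt_eqF.
  exact: approximable_poly.
rewrite addr0; set z := r^-1 * x.
have z1 : `|z| <= 1 by rewrite normrM normfV (gtr0_norm r0) ler_pdivrMl// mulr1.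
have [/andP[p0 pz]] := abs_polyP n z z1.
have -> : x = r * z by rewrite mulrA divff ?mul1r// gt_eqF.
rewrite (normrM r z) (gtr0_norm r0) -mulrBr.
move: (abs_poly n).[z] `|z| (normr_ge0 z) p0 pz z1 => p t t0 p0 pt t1 H.
rewrite normrM (gtr0_norm r0) ger0_norm ?subr_ge0//.
have [t00|t_gt0] := eqVneq t 0.
  have -> : t - p = 0 by lra.
  by rewrite mulr0 ltW.
have tp : 0 < t by rewrite lt_neqAle eq_sym t_gt0.
(* Cancelling [t] leaves an error of at most [2 / n], uniform in the point. *)
have D : (t - p) * n%:R <= 2.
  have : (t - p) * (n%:R * (t / 2)) <= t.
    by apply: le_trans H; rewrite ler_wpM2l ?subr_ge0// lerDr.
  rewrite (_ : _ * _ = ((t - p) * n%:R / 2) * t); last by field.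
  by rewrite ger_pMl// ler_pdivrMr// mul1r.
rewrite -(ler_pM2r n0) -mulrA.
apply: (@le_trans _ _ (r * 2)); first by rewrite ler_pM2l.
by rewrite [r * 2]mulrC [e * _]mulrC -ler_pdivrMr// ltW.
Qed.

Lemma approximable_clamp01 : approximable (@clamp01 R).
Proof.
have H := approximableZ 2^-1 _ (approximableD _ _ (approximableD _ _ approximable_norm
  (approximableZ (-1) _ (approximable_affine _ 1 (-1) (oner_neq0 _) approximable_norm)))
  (approximable_cst 1)).
rewrite (_ : @clamp01 R = fun x => 2^-1 * (`|x| + -1 * `|1 * x + -1| + 1))//.
by apply/funext => x; rewrite /clamp01 mul1r; field.
Qed.

Lemma approximable_staircase (v : nat -> R) (w : R) M (a b : R) : a != 0 -> w != 0 ->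
  approximable (fun x => staircase R v w M (a * x + b)).
Proof.
move=> a0 w0; elim: M => [|M IH] /=; first exact: approximable_cst.
apply: approximableD => //; apply: approximableZ.
have H := approximable_affine _ (a / w) ((b - M%:R) / w) _ approximable_clamp01.
rewrite (_ : (fun x => _) = fun x => clamp01 R (a / w * x + (b - M%:R) / w)).
  by apply: H; rewrite mulf_neq0// invr_eq0.
by apply/funext => x; congr clamp01; field.
Qed.

End Approximable.

(** * Counting and digits *)

(** The lowest digit is the residue modulo [b], and division by [b] shifts the others down. The
    multiple of [b ^ d] leaves these digits alone and will carry the high part of a code. *)
Lemma digit_sum b d A (J : 'I_d -> nat) : (forall p, (J p < b)%N) ->
  forall p : 'I_d, (((\sum_(i < d) J i * b ^ i + b ^ d * A) %/ b ^ p) %% b = J p)%N.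
Proof.
elim: d A J => [|d IH] A J Jb p; first by case: p.
have b0 : (0 < b)%N by exact: leq_ltn_trans (Jb p).
rewrite big_ord_recl/= expn0 muln1.
have -> : (\sum_(i < d) J (lift ord0 i) * b ^ bump 0 i =
    b * \sum_(i < d) J (lift ord0 i) * b ^ i)%N.
  by rewrite big_distrr/=; apply: eq_bigr => i _; rewrite /bump/= expnS mulnCA.
rewrite expnS -mulnA -addnA -mulnDr [(b * _)%N]mulnC addnC.
have [i ->|->] := unliftP ord0 p; last first.
  by rewrite expn0 divn1 modnMDl modn_small.
rewrite /= /bump/= expnS divnMA divnMDl// (@divn_small (J ord0)) ?Jb// addn0.
by rewrite IH.
Qed.

(** Each [p] excludes a single residue, so the excluded [q] lie in the image of a map from
    ['I_d]. *)
Lemma card_residue_class d m (z : 'I_d -> nat) :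
  (#|~: [set q : 'I_m | [forall p, (z p + q) %% m != 0]]| <= d)%N.
Proof.
have [->|m0] := posnP m; first by rewrite (leq_trans (max_card _))// card_ord.
pose g (p : 'I_d) : 'I_m := Ordinal (ltn_pmod (m - z p %% m) m0).
rewrite -[X in (_ <= X)%N](card_ord d) (leq_trans _ (leq_imset_card g predT))//.
apply/subset_leq_card/fintype.subsetP => q; rewrite !inE negb_forall => /existsP[p].
rewrite negbK => /eqP zq; apply/imsetP; exists p => //; apply/val_inj => /=.
have := ltn_ord q; move: zq; rewrite -modnDml.
have := ltn_pmod (z p) m0; move: (z p %% m)%N => r rm zq qm.
have [r0|r0] := posnP r.
  by move: zq; rewrite r0 add0n subn0 modnn modn_small.
rewrite (@modn_small (m - r)%N); last by rewrite ltn_subrL r0.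
have : (m <= r + q)%N.
  by rewrite leqNgt; apply/negP => /modn_small; rewrite zq => /esym/eqP; rewrite addn_eq0 gtn_eqF.
move=> mrq; move: zq; rewrite -(subnK mrq) modnDr modn_small; lia.
Qed.

(** With [g = #|G| / (d + 1) >= 1], the terms in [G] overshoot [v] by about [(g - 1) * v] and each
    other term costs at most [F / (d + 1)]. As there are [2d + 1] terms, this adds up to
    [d / (d + 1) * F], and [g <= 2] bounds the accumulated error by [e]. *)
Lemma vote_bound (R : realType) (I : finType) (G : {set I}) (d : nat)
    (c : I -> R) (v F e : R) :
  #|I| = (2 * d + 1)%N -> (#|~: G| <= d)%N -> 0 < e -> `|v| <= F ->
  (forall q, `|c q| <= F / d.+1%:R) ->
  (forall q, q \in G -> `|c q - v / d.+1%:R| <= e / 2 / d.+1%:R) ->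
  `|v - \sum_q c q| <= d%:R / d.+1%:R * F + e.
Proof.
move=> cI cG e0 vF cF cv.
have D0 : 0 < d.+1%:R :> R by rewrite ltr0n.
have DN : d.+1%:R != 0 :> R by rewrite gt_eqF.
have F0 : 0 <= F by exact: le_trans vF.
have cGC := cardsC G; rewrite cI in cGC.
have gd : (d.+1 <= #|G|)%N by lia.
pose g := #|G|%:R / d.+1%:R : R.
have g1 : 1 <= g by rewrite ler_pdivlMr// mul1r ler_nat.
have -> : v - \sum_q c q =
    v * (1 - g) - (\sum_(q in G) (c q - v / d.+1%:R) + \sum_(q in ~: G) c q).
  have -> : \sum_(q in ~: G) c q = \sum_(q | q \notin G) c q.
    by apply: eq_bigl => q; rewrite finset.in_setC.
  rewrite (bigID (mem G))/= sumrB sumr_const -[_ *+ #|G|]mulr_natr.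
  by rewrite /g; field.
have h1 : `|v * (1 - g)| <= F * (g - 1).
  by rewrite normrM [`|1 - g|]distrC [`|g - 1|]ger0_norm ?subr_ge0// ler_wpM2r ?subr_ge0.
have h2 : `|\sum_(q in G) (c q - v / d.+1%:R)| <= g * (e / 2).
  rewrite (le_trans (ler_norm_sum _ _ _))// (le_trans (ler_sum _ cv))//.
  rewrite sumr_const -[_ *+ #|G|]mulr_natr le_eqVlt; apply/orP; left; apply/eqP.
  by rewrite /g; field.
have h3 : `|\sum_(q in ~: G) c q| <= #|~: G|%:R * (F / d.+1%:R).
  rewrite (le_trans (ler_norm_sum _ _ _))// (le_trans (ler_sum _ (fun q _ => cF q)))//.
  by rewrite sumr_const mulr_natl.
rewrite (le_trans (ler_normB _ _))// (le_trans (lerD h1 (ler_normD _ _)))//.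
rewrite (le_trans (lerD (lexx _) (lerD h2 h3)))//.
have gE : g + #|~: G|%:R / d.+1%:R = d%:R / d.+1%:R + 1.
  rewrite /g -mulrDl -natrD cGC (_ : (2 * d + 1)%N = (d + d.+1)%N); last by lia.
  by rewrite natrD mulrDl divff.
have d1 : d%:R / d.+1%:R <= 1 :> R by rewrite ler_pdivrMr// mul1r ler_nat.
have cp : 0 <= #|~: G|%:R / d.+1%:R :> R by rewrite divr_ge0// ltW.
rewrite (_ : #|~: G|%:R * (F / d.+1%:R) = #|~: G|%:R / d.+1%:R * F); last by field.
have aux (g' t u : R) : g' + u = t + 1 -> 0 <= u -> t <= 1 ->
    F * (g' - 1) + (g' * (e / 2) + u * F) <= t * F + e.
  move=> guE u0 t1; have -> : u = t + 1 - g' by lra.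
  rewrite (_ : _ + _ = t * F + g' / 2 * e); last by field.
  by rewrite lerD2l ler_piMl ?(ltW e0)//; lra.
exact: aux.
Qed.

(** * One step of the superposition scheme *)

Lemma unit_cube_compact (R : realType) d : compact (@unit_cube R d).
Proof.
have := @rV_compact R d (fun=> `[0, 1]) (fun=> @segment_compact _ _ _).
by congr compact; apply/seteqP; split=> x /= H i; have := H i; rewrite /= in_itv.
Qed.

Lemma unit_cube_unif_cont (R : realType) d (f : 'rV[R]_d -> R) :
  {within @unit_cube R d, continuous f} -> forall e, 0 < e ->
  exists2 delta, 0 < delta & forall x y, @unit_cube R d x -> @unit_cube R d y ->
    (forall p, `|x ord0 p - y ord0 p| < delta) -> `|f x - f y| < e.
Proof.
move=> cf e e0.
have [delta d0 H] := compact_unif_cont R _ _ f (unit_cube_compact R d) cf e e0.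
exists delta => // x y cx cy xy; apply: H => //; split=> // i p.
by rewrite !ord1; exact: xy.
Qed.

Lemma common_delta (R : realType) (I : finType) (P : I -> R -> Prop) :
  (forall i a b, 0 < a -> a <= b -> P i b -> P i a) ->
  (forall i, exists2 a, 0 < a & P i a) -> exists2 a, 0 < a & forall i, P i a.
Proof.
move=> mono HP.
have H (s : seq I) : exists2 a, 0 < a & forall i, i \in s -> P i a.
  elim: s => [|i s [a a0 IH]]; first by exists 1.
  have [b b0 Pb] := HP i; have ab : 0 < Num.min a b by rewrite lt_min a0.
  exists (Num.min a b) => // j; rewrite in_cons => /predU1P[->|js].
    by apply: mono Pb => //; rewrite ge_min lexx orbT.
  by apply: mono (IH j js) => //; rewrite ge_min lexx.
by have [a a0 Ha] := H (enum I); exists a => // i; apply: Ha; rewrite mem_enum.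
Qed.

(** The interval [[z, z + 1]] thus stays in its block of length [m] and misses the first unit of the
    block, which is the gap. *)
Lemma divn_cell z m : (0 < z %% m)%N -> (0 < m)%N ->
  (m * (z %/ m) < z)%N /\ (z < m * (z %/ m).+1)%N.
Proof.
move=> zm m0; rewrite {2 3}(divn_eq z m) mulnS mulnC; split.
  by rewrite -[X in (X < _)%N]addn0 ltn_add2l.
by rewrite addnC ltn_add2r ltn_pmod.
Qed.

Section Step.
Variables (R : realType) (K : R -> R).
Hypothesis cK : continuous K.
Hypothesis nK : ~ is_poly_fun K.
Variable d : nat.
Local Notation m := (2 * d + 1)%N.
Local Notation cube := (@unit_cube R d).
Variables (f : 'rV[R]_d -> R) (F : R) (phi : 'I_d -> 'I_m -> R -> R).
Variables (delta e : R) (N : nat).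
Implicit Types (x y s : R) (p : 'I_d) (q : 'I_m) (j k : nat).
Hypotheses (delta0 : 0 < delta) (e0 : 0 < e) (N0 : (0 < N)%N).
Hypothesis fF : forall x : 'rV[R]_d, cube x -> `|f x| <= F.
Hypothesis phi0 : forall p q x, 0 <= phi p q x.
Hypothesis fN : forall x y : 'rV[R]_d, cube x -> cube y ->
  (forall p, `|x ord0 p - y ord0 p| <= N%:R^-1) -> `|f x - f y| <= e / 2.
Hypothesis phiN : forall p q x y, 0 <= x <= 1 -> 0 <= y <= 1 ->
  `|x - y| <= N%:R^-1 -> `|phi p q x - phi p q y| <= delta / 2.

(** Both the width of a gap and the shift between successive copies, so that the [m] gaps tile one
    period. *)
Let w : R := m%:R^-1.
(** The nodes of [psi] are numbered from [0] to [N.+1] and serve as digits in base [b]; [B] leaves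
    room for [d] digits. *)
Let b := N.+2.
Let B := (b ^ d)%N.
(** [phi] is rounded down to multiples of [h]. One unit of code is worth [eps], so all low digits
    together are worth less than [h]. *)
Let h := delta / 2.
Let eps := h / B%:R.
(** In this coordinate copy [q] has period 1, with gaps [[j, j + w]] and cells [[j + w, j + 1]]. *)
Let pos (q : 'I_m) (x : R) := N%:R * x + q%:R * w.
(** The point where [pos q] equals [j], moved into [[0, 1]] so that [f] and [phi] can be sampled
    there. *)
Let xi (q : 'I_m) (j : nat) : R := clamp01 R ((j%:R - q%:R * w) / N%:R).
Let level p q j := Num.trunc (phi p q (xi q j) / h).
(* The low [d] digits in base [b] of a sum of codes over [p] identify the cell
   of the cube; the high part makes the step function follow [phi]. *)
Let code (p : 'I_d) (q : 'I_m) (j : nat) := (j * b ^ p + B * level p q j)%N.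
Let psi p q x := staircase R (fun j => eps * (code p q j)%:R) w N.+1 (pos q x).
Let ctr (q : 'I_m) (k : nat) : 'rV[R]_d :=
  \row_p xi q ((k %/ b ^ p) %% b)%N.
(** A crude bound on any sum of one code per coordinate, so that [Psi] has enough nodes. *)
Let T q := (\sum_(p < d) \sum_(j < b) code p q j)%N.
Let Psi q s := staircase R (fun k => f (ctr q k) / d.+1%:R) 1 (T q) (eps^-1 * s + 0).

Let NR : 0 < N%:R :> R. Proof. by rewrite ltr0n. Qed.
Let mR : 0 < m%:R :> R. Proof. by rewrite ltr0n addn1. Qed.
Let w0 : 0 < w. Proof. by rewrite invr_gt0. Qed.
Let w1 : w <= 1. Proof. by rewrite invf_le1// ler1n addn1. Qed.
Let h0 : 0 < h. Proof. by rewrite divr_gt0. Qed.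
Let B0 : 0 < B%:R :> R. Proof. by rewrite ltr0n expn_gt0. Qed.
Let eps0 : 0 < eps. Proof. by rewrite divr_gt0. Qed.

Let xi01 q j : 0 <= xi q j <= 1. Proof. exact: clamp01_itv. Qed.

Let ctr_cube q k : cube (ctr q k).
Proof. by move=> p; rewrite mxE. Qed.

Let posN q x : 0 <= x <= 1 -> 0 <= pos q x < N.+1%:R.
Proof.
move=> /andP[x0 x1]; rewrite /pos addr_ge0 ?mulr_ge0// ?(ltW w0)//=.
rewrite -[N.+1%:R]natr1 ler_ltD ?ler_piMr// /w ltr_pdivrMr// mul1r ltr_nat.
exact: ltn_ord.
Qed.

Let xi_dist q x j : 0 <= x <= 1 -> `|pos q x - j%:R| <= 1 ->
  `|x - xi q j| <= N%:R^-1.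
Proof.
move=> x01 yj; rewrite (le_trans (clamp01_dist _ _ _ x01))//.
rewrite (_ : x - _ = (pos q x - j%:R) / N%:R); last first.
  by rewrite /pos; field; rewrite gt_eqF.
by rewrite normrM normfV (gtr0_norm NR) ler_pdivrMr// mulVf// gt_eqF.
Qed.

(** The low digit adds at most [h] and rounding down removes at most [h]; the signs are opposite, so
    the errors do not accumulate. *)
Let code_close p q j : (j < b)%N ->
  `|eps * (code p q j)%:R - phi p q (xi q j)| <= h.
Proof.
move=> jb; have low : eps * (j * b ^ p)%:R <= h.
  rewrite /eps mulrAC ler_pdivrMr// ler_pM2l// ler_nat.
  rewrite (@leq_trans (b ^ p.+1))//; first by rewrite expnS leq_mul2r ltnW ?orbT.
  by rewrite leq_exp2l.
have low0 : 0 <= eps * (j * b ^ p)%:R by rewrite mulr_ge0// ltW.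
have /truncn_itv : 0 <= phi p q (xi q j) / h by rewrite divr_ge0// ltW.
rewrite -/(level p q j) ler_pdivlMr// ltr_pdivrMr// -natr1 => /andP[l1 l2].
rewrite /code natrD natrM mulrDr.
have -> : eps * (B * level p q j)%:R = (level p q j)%:R * h.
  by rewrite natrM /eps; field; rewrite gt_eqF.
move: low low0 l1 l2; rewrite natrM; move: (eps * _) (phi _ _ _) (level _ _ _)%:R => a y l.
by rewrite ler_norml => ? ? ? ?; apply/andP; split; lra.
Qed.

(** Between two nodes [psi] is a convex combination of their scaled codes, each within [h] of [phi]
    at a sample point no farther than [1 / N] from [x]; and [h + delta / 2 = delta]. *)
Let psi_close p q x : 0 <= x <= 1 -> `|psi p q x - phi p q x| <= delta.
Proof.
move=> x01; have /andP[y0 yN] := posN q x x01.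
pose j := Num.trunc (pos q x).
have /andP[jy yj] : j%:R <= pos q x < j.+1%:R by exact: truncn_itv.
have jN : (j < N.+1)%N by rewrite -(ltr_nat R) (le_lt_trans jy).
have close i : (i < b)%N -> `|pos q x - i%:R| <= 1 ->
    `|eps * (code p q i)%:R - phi p q x| <= delta.
  move=> ib yi; have H1 := code_close p q i ib.
  have H2 := phiN p q _ _ (xi01 q i) x01.
  rewrite distrC in H2; have {}H2 := H2 (xi_dist q x i x01 yi).
  rewrite (_ : _ - _ = (eps * (code p q i)%:R - phi p q (xi q i)) +
    (phi p q (xi q i) - phi p q x)); last by ring.
  rewrite (le_trans (ler_normD _ _))// (le_trans (lerD H1 H2))//.
  by rewrite /h -splitr.
have jyj : j%:R <= pos q x <= j.+1%:R by rewrite jy ltW.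
rewrite /psi (staircaseE _ _ _ w0 w1 N.+1 j)//.
have Hj : `|eps * (code p q j)%:R - phi p q x| <= delta.
  apply: close; first by rewrite ltnW.
  by rewrite ger0_norm ?subr_ge0//; move: yj; rewrite -natr1; lra.
have HS : `|eps * (code p q j.+1)%:R - phi p q x| <= delta.
  apply: close; first by [].
  rewrite ler0_norm ?subr_le0; last exact: ltW.
  by move: jy; rewrite -[j.+1%:R]natr1; lra.
have /andP[c0 c1] := clamp01_itv R ((pos q x - j%:R) / w).
move: (clamp01 R _) c0 c1 Hj HS => c c0 c1.
move: (eps * _) (eps * _) (phi p q x) => u v z.
rewrite !ler_norml => /andP[? ?] /andP[? ?]; apply/andP; split; nra.
Qed.

Let psi_ge0 p q x : 0 <= psi p q x.
Proof.
rewrite /psi; have [j [t [/andP[t0 t1] ->]]] :=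
  staircase_segment _ (fun j => eps * (code p q j)%:R) _ w0 w1 N.+1 (pos q x).
have H i : 0 <= eps * (code p q i)%:R by rewrite mulr_ge0// ltW.
have := H j; have := H j.+1; nra.
Qed.

(** Index of the interval of length [1 / (m * N)] containing the coordinate; it lies in a half-open
    gap of copy [q] exactly when [m] divides [slot x p + q]. *)
Let slot (x : 'rV[R]_d) p := Num.trunc (m%:R * N%:R * x ord0 p).
Let good (x : 'rV[R]_d) : {set 'I_m} :=
  [set q : 'I_m | [forall p, (slot x p + q) %% m != 0]%N]%SET.

(** On a good copy all inner functions are flat, so their sum is exactly [eps * k] and [Psi] is at a
    node. The digits of [k] recover a point within [1 / N] of [x] in each coordinate. *)
Let good_value (x : 'rV[R]_d) q : cube x -> q \in good x ->
  `|Psi q (\sum_p psi p q (x ord0 p)) - f x / d.+1%:R| <= e / 2 / d.+1%:R.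
Proof.
move=> cx; rewrite finset.in_set => /forallP gq.
pose j p := ((slot x p + q) %/ m)%N.
have cell p : (j p < N.+1)%N /\ (j p)%:R + w <= pos q (x ord0 p) <= (j p).+1%:R.
  have /andP[x0 x1] := cx p.
  have /truncn_itv : 0 <= m%:R * N%:R * x ord0 p by rewrite !mulr_ge0.
  rewrite -/(slot x p) => /andP[z1 z2].
  have gp := gq p; rewrite -lt0n in gp.
  have m0 : (0 < m)%N by rewrite addn1.
  have [jlo jhi] := divn_cell _ _ gp m0.
  have yE : m%:R * pos q (x ord0 p) = m%:R * N%:R * x ord0 p + q%:R.
    by rewrite /pos /w; field; rewrite gt_eqF.
  have lo : (j p)%:R + w <= pos q (x ord0 p).
    rewrite -(ler_pM2l mR) yE mulrDr mulfV ?gt_eqF//.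
    apply: (@le_trans _ _ (slot x p + q)%:R); last by rewrite natrD lerD2r.
    by rewrite -natrM natr1 ler_nat.
  have hi : pos q (x ord0 p) <= (j p).+1%:R.
    rewrite -(ler_pM2l mR) yE.
    apply: (@le_trans _ _ (slot x p + q).+1%:R).
      by rewrite -(addSn (slot x p) q) (natrD _ (slot x p).+1) lerD2r ltW.
    by rewrite -natrM ler_nat.
  split; last by rewrite lo.
  have /andP[_ yN] := posN q (x ord0 p) (cx p).
  by rewrite -(ltr_nat R) (le_lt_trans _ yN)// (le_trans _ lo)// lerDl ltW.
(* The successor appears because on cell [j] a staircase has the value of its right-hand node. *)
pose k := (\sum_p code p q (j p).+1)%N.
have -> : \sum_p psi p q (x ord0 p) = eps * k%:R.
  rewrite /k natr_sum mulr_sumr; apply: eq_bigr => p _.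
  by have [? ?] := cell p; rewrite /psi (staircase_cell _ _ _ w0 w1 _ (j p)).
have -> : Psi q (eps * k%:R) = f (ctr q k) / d.+1%:R.
  rewrite /Psi addr0 mulKf ?gt_eqF// staircase_nat//.
  apply: leq_sum => p _.
  have jb : ((j p).+1 < b)%N by have [] := cell p.
  by rewrite (bigD1 (Ordinal jb))//= leq_addr.
rewrite -mulrBl normrM normfV [`|d.+1%:R|]ger0_norm// ler_wpM2r ?invr_ge0//.
apply: fN => // p; rewrite mxE distrC.
have -> : ((k %/ b ^ p) %% b)%N = (j p).+1.
  rewrite /k /code big_split/= -big_distrr/=.
  by rewrite (digit_sum b d _ (fun p => (j p).+1))// => p'; have [] := cell p'.
apply: xi_dist => //; have [_ /andP[lo hi]] := cell p.
rewrite ler0_norm ?subr_le0//; move: lo w0; rewrite -[(j p).+1%:R]natr1; lra.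
Qed.

(** Interpolation never leaves the range of the nodes. All real [s] matter: on bad copies the inner
    sum may fall between nodes. *)
Let Psi_bound q s : `|Psi q s| <= F / d.+1%:R.
Proof.
rewrite /Psi; have [j [t [/andP[t0 t1] ->]]] :=
  staircase_segment _ (fun k => f (ctr q k) / d.+1%:R) _ ltr01 (lexx 1) (T q) (eps^-1 * s + 0).
have H k : `|f (ctr q k) / d.+1%:R| <= F / d.+1%:R.
  rewrite normrM normfV [`|d.+1%:R|]ger0_norm// ler_wpM2r ?invr_ge0//.
  exact: fF.
move: (H j) (H j.+1); rewrite !ler_norml.
move: (_ / _) (_ / _) (_ / _) => A1 A2 A3.
by move=> /andP[? ?] /andP[? ?]; apply/andP; split; nra.
Qed.

Lemma superposition_grid :
  exists (Phi : 'I_m -> R -> R) (phi' : 'I_d -> 'I_m -> R -> R),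
  [/\ (forall q, approximable R K (Phi q)),
      (forall p q, approximable R K (phi' p q)),
      (forall p q x, 0 <= phi' p q x),
      (forall p q x, 0 <= x <= 1 -> `|phi' p q x - phi p q x| <= delta) &
      (forall x : 'rV[R]_d, cube x -> `|f x - npkan Phi phi' x| <= d%:R / d.+1%:R * F + e)].
Proof.
exists Psi, psi; split.
- by move=> q; apply: approximable_staircase; rewrite ?invr_eq0 ?gt_eqF.
- by move=> p q; apply: approximable_staircase; rewrite ?gt_eqF.
- by move=> p q x; exact: psi_ge0.
- by move=> p q x; exact: psi_close.
- move=> x cx; apply: (vote_bound R _ (good x)); rewrite ?card_ord//.
  + exact: card_residue_class.
  + exact: fF.
  + by move=> q; exact: good_value.
Qed.
End Step.

(** * Iteration *)

Section Network.
Variables (R : realType) (d : nat).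
Local Notation m := (2 * d + 1)%N.
Local Notation cube := (@unit_cube R d).
Implicit Types (Phi : 'I_m -> R -> R) (phi : 'I_d -> 'I_m -> R -> R).
Implicit Types (x : 'rV[R]_d) (e delta F : R).

Definition inner phi q x := \sum_(p < d) phi p q (x ord0 p).

Lemma inner_continuous phi q : (forall p q, continuous (phi p q)) ->
  continuous (inner phi q).
Proof.
move=> cphi; apply: continuous_big => [|p _ x]; first exact: (@add_continuous R^o).
apply: (@continuous_comp _ _ _ (fun y : 'rV[R]_d => y ord0 p) (phi p q)).
  exact: coord_continuous.
exact: cphi.
Qed.

Lemma npkan_continuous Phi phi : (forall q, continuous (Phi q)) ->
  (forall p q, continuous (phi p q)) -> continuous (npkan Phi phi).
Proof.
move=> cPhi cphi; apply: continuous_big => [|q _ x]; first exact: (@add_continuous R^o).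
apply: (@continuous_comp _ _ _ (inner phi q) (Phi q)); last exact: cPhi.
exact: inner_continuous.
Qed.

Lemma inner_dist phi phi' q x delta :
  (forall p t, 0 <= t <= 1 -> `|phi' p q t - phi p q t| <= delta / d.+1%:R) ->
  0 <= delta -> cube x -> `|inner phi' q x - inner phi q x| <= delta.
Proof.
move=> H d0 cx; rewrite /inner -sumrB (le_trans (ler_norm_sum _ _ _))//.
apply: (@le_trans _ _ (\sum_(p < d) delta / d.+1%:R)).
  by apply: ler_sum => p _; exact/H/cx.
rewrite sumr_const card_ord -[X in X <= _]mulr_natr mulrAC ler_pdivrMr ?ltr0n//.
by rewrite ler_wpM2l// ler_nat.
Qed.

(** On the cube the inner sums are bounded, and [Phi q] is uniformly continuous on bounded sets. [C]
    also bounds the perturbed sums, fixing the range on which the outer functions are later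
    approximated. *)
Lemma npkan_perturb Phi phi e : 0 < e -> (forall q, continuous (Phi q)) ->
  (forall p q, continuous (phi p q)) ->
  exists2 delta, 0 < delta & exists C, 0 < C /\ forall phi',
    (forall p q t, 0 <= t <= 1 -> `|phi' p q t - phi p q t| <= delta) ->
    forall x, cube x -> (forall q, `|inner phi' q x| <= C) /\
      `|npkan Phi phi' x - npkan Phi phi x| <= e.
Proof.
move=> e0 cPhi cphi; have m0 : 0 < m%:R :> R by rewrite ltr0n addn1.
(* Bound and closeness share a parameter inherited by smaller values, so one [a] serves all [q]; its
   inverse becomes [C]. *)
pose P q a := forall x s, cube x -> `|s - inner phi q x| <= a ->
  `|s| <= a^-1 /\ `|Phi q s - Phi q (inner phi q x)| <= e / m%:R.
have [q a b a0 ab Pb x s cx sa|q|a a0 Pa] := common_delta R _ P.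
- have [s1 s2] := Pb x s cx (le_trans sa ab); split=> //.
  by rewrite (le_trans s1)// lef_pV2 ?posrE// (lt_le_trans a0).
- have [C C0 HC] := compact_norm_bounded R _ _ (inner phi q) (unit_cube_compact R d)
    (continuous_subspaceT (inner_continuous phi q cphi)).
  have [|a a0 Ha] := unif_cont_bounded R (Phi q) (cPhi q) (C + 1) (e / m%:R).
    by rewrite divr_gt0.
  have C10 : 0 < C + 1 by rewrite ltr_wpDl// ltW.
  (* The three terms respect the modulus of [Phi q], keep [s] within [C + 1], and make [a'^-1] at
     least [C + 1]. *)
  pose a' := Num.min (a / 2) (Num.min 1 (C + 1)^-1).
  have a'0 : 0 < a' by rewrite !lt_min divr_gt0// ltr01 invr_gt0 C10.
  have a'a : a' <= a / 2 by rewrite ge_min lexx.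
  have a'1 : a' <= 1 by rewrite !ge_min lexx orbT.
  have a'C : a' <= (C + 1)^-1 by rewrite !ge_min lexx !orbT.
  exists a' => // x s cx sa; have iC := HC x cx.
  have sC : `|s| <= C + 1.
    rewrite -[s](subrK (inner phi q x)) addrC (le_trans (ler_normD _ _))//.
    by rewrite lerD// (le_trans sa).
  split; first by rewrite (le_trans sC)// -[C + 1]invrK lef_pV2 ?posrE ?invr_gt0.
  apply/ltW/Ha => //; first by rewrite (le_trans iC)// lerDl.
  by rewrite (le_lt_trans sa)// (le_lt_trans a'a)//; lra.
exists (a / d.+1%:R); first by rewrite divr_gt0// ltr0n.
exists a^-1; rewrite invr_gt0; split=> // phi' H x cx.
have Hq q := Pa q x (inner phi' q x) cx
  (inner_dist phi phi' q x a (fun p => H p q) (ltW a0) cx).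
split=> [q|]; first by have [] := Hq q.
rewrite /npkan -sumrB (le_trans (ler_norm_sum _ _ _))//.
apply: (@le_trans _ _ (\sum_(q < m) e / m%:R)).
  by apply: ler_sum => q _; have [] := Hq q.
by rewrite sumr_const card_ord -[X in X <= _]mulr_natr divfK// gt_eqF.
Qed.

Variable K : R -> R.
Hypothesis cK : continuous K.
Hypothesis nK : ~ is_poly_fun K.

Lemma superposition_step (f : 'rV[R]_d -> R) F phi delta e :
  {within cube, continuous f} -> (forall x, cube x -> `|f x| <= F) ->
  (forall p q, continuous (phi p q)) -> (forall p q t, 0 <= phi p q t) ->
  0 < delta -> 0 < e ->
  exists (Phi : 'I_m -> R -> R) (phi' : 'I_d -> 'I_m -> R -> R),
  [/\ (forall q, approximable R K (Phi q)),
      (forall p q, approximable R K (phi' p q)),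
      (forall p q t, 0 <= phi' p q t),
      (forall p q t, 0 <= t <= 1 -> `|phi' p q t - phi p q t| <= delta) &
      (forall x, cube x -> `|f x - npkan Phi phi' x| <= d%:R / d.+1%:R * F + e)].
Proof.
move=> cf fF cphi phi0 delta0 e0.
have [|a a0 Ha] := unit_cube_unif_cont R d f cf (e / 2); first by rewrite divr_gt0.
pose P (pq : 'I_d * 'I_m) c := forall s t : R, 0 <= s <= 1 -> 0 <= t <= 1 ->
  `|s - t| < c -> `|phi pq.1 pq.2 s - phi pq.1 pq.2 t| <= delta / 2.
have [pq c c' c0 cc' Pc s t s01 t01 st|pq|c c0 Pc] := common_delta R _ P.
- by apply: Pc => //; exact: lt_le_trans st cc'.
- have [|c c0 Hc] := unif_cont_bounded R _ (cphi pq.1 pq.2) 1 (delta / 2).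
    by rewrite divr_gt0.
  exists c => // s t /andP[s0 s1] /andP[t0 t1] st.
  by apply/ltW/Hc => //; rewrite ger0_norm.
pose mn := Num.min a c; have mn0 : 0 < mn by rewrite lt_min a0.
pose N := (Num.bound mn^-1).+1.
have N0 : 0 < N%:R :> R by rewrite ltr0n.
have Nmn : N%:R^-1 < mn.
  rewrite -[mn]invrK ltf_pV2 ?posrE ?invr_gt0//.
  have : mn^-1 < (Num.bound mn^-1)%:R by apply: archi_boundP; rewrite invr_ge0 ltW.
  by move=> /lt_le_trans; apply; rewrite ler_nat.
apply: (superposition_grid R K cK nK d f F phi delta e N) => //.
- move=> x y cx cy xy; apply/ltW/Ha => // p.
  by rewrite (le_lt_trans (xy p))// (lt_le_trans Nmn)// ge_min lexx.
- move=> p q s t s01 t01 st; apply: (Pc (p, q)) => //.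
  by rewrite (le_lt_trans st)// (lt_le_trans Nmn)// ge_min lexx orbT.
Qed.

(* The perturbation of the inner functions is chosen after the outer ones, so
   the error already achieved survives it; this replaces the Baire category
   argument of the exact superposition theorem. *)
Lemma superposition_iter (f : 'rV[R]_d -> R) F n :
  {within cube, continuous f} -> 0 < F -> (forall x, cube x -> `|f x| <= F) ->
  exists (Phi : 'I_m -> R -> R) (phi : 'I_d -> 'I_m -> R -> R),
  [/\ (forall q, approximable R K (Phi q)),
      (forall p q, approximable R K (phi p q)),
      (forall p q t, 0 <= phi p q t) &
      (forall x, cube x ->
        `|f x - npkan Phi phi x| <= ((2 * d + 1)%:R / (2 * d + 2)%:R) ^+ n * F)].
Proof.
move=> cf F0 fF; elim: n => [|n [Phi [phi [aPhi aphi phi0 H]]]].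
  exists (fun _ _ => 0), (fun _ _ _ => 0); split=> //.
  - by move=> q; exact: approximable_cst.
  - by move=> p q; exact: approximable_cst.
  by move=> x cx; rewrite /npkan big1// subr0 expr0 mul1r fF.
set rho : R := _ / _ in H *.
have D0 : 0 < d.+1%:R :> R by rewrite ltr0n.
have D20 : 0 < (2 * d + 2)%:R :> R by rewrite ltr0n addn2.
have rho0 : 0 < rho by rewrite divr_gt0// ltr0n ?addn1 ?addn2.
pose Fn := rho ^+ n * F; have Fn0 : 0 < Fn by rewrite mulr_gt0// exprn_gt0.
(* Spent twice, on the new step and on the perturbation: [d / (d + 1) + 2 / (4 * (d + 1)) = (2d + 1)
   / (2d + 2)]. *)
pose e := Fn / (4 * d.+1%:R); have e0 : 0 < e by rewrite divr_gt0// mulr_gt0.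
have cPhi q : continuous (Phi q) by have [] := aPhi q.
have cphi p q : continuous (phi p q) by have [] := aphi p q.
have [delta delta0 [C [_ Hdelta]]] := npkan_perturb Phi phi e e0 cPhi cphi.
have cg : {within cube, continuous (fun x => f x - npkan Phi phi x)}.
  move=> x; apply: cvgB; first exact: cf.
  exact: (continuous_subspaceT (npkan_continuous Phi phi cPhi cphi)).
have [Phi' [phi' [aPhi' aphi' phi'0 close H']]] :=
  superposition_step _ Fn phi delta e cg H cphi phi0 delta0 e0.
(* Both networks share the inner functions [phi'], so adding outer functions keeps their number at
   [2d + 1]. *)
exists (fun q s => Phi q s + Phi' q s), phi'; split=> //.
  by move=> q; exact: approximableD.
move=> x cx; have [_ H1] := Hdelta phi' close x cx; have H2 := H' x cx.
have -> : npkan (fun q s => Phi q s + Phi' q s) phi' x =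
    npkan Phi phi' x + npkan Phi' phi' x by rewrite /npkan big_split.
rewrite (_ : _ - _ = (f x - npkan Phi phi x - npkan Phi' phi' x) -
  (npkan Phi phi' x - npkan Phi phi x)); last by ring.
rewrite (le_trans (ler_normB _ _))// (le_trans (lerD H2 H1))//.
have -> : rho ^+ n.+1 * F = rho * Fn by rewrite exprS mulrA.
rewrite /e /rho le_eqVlt; apply/orP; left; apply/eqP.
have -> : (2 * d + 1)%:R = 2 * d%:R + 1 :> R by rewrite natrD natrM.
have -> : (2 * d + 2)%:R = 2 * d.+1%:R :> R by rewrite -natrM; congr _%:R; lia.
have dE : d.+1%:R = d%:R + 1 :> R by rewrite natr1.
by move: D0; rewrite dE => /lt0r_neq0 dn0; field.
Qed.

Lemma superposition_approx (f : 'rV[R]_d -> R) e :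
  {within cube, continuous f} -> 0 < e ->
  exists (Phi : 'I_m -> R -> R) (phi : 'I_d -> 'I_m -> R -> R),
  [/\ (forall q, approximable R K (Phi q)),
      (forall p q, approximable R K (phi p q)) &
      (forall x, cube x -> `|f x - npkan Phi phi x| <= e)].
Proof.
move=> cf e0.
have [F F0 fF] := compact_norm_bounded R _ _ f (unit_cube_compact R d) cf.
set rho : R := (2 * d + 1)%:R / (2 * d + 2)%:R.
have rho0 : 0 <= rho by rewrite divr_ge0.
have rho1 : `|rho| < 1.
  by rewrite ger0_norm// /rho ltr_pdivrMr ?ltr0n ?addn2// mul1r ltr_nat addn1.
have /cvgrPdist_lt /(_ (e / F)) := cvg_expr rho1.
rewrite divr_gt0// => /(_ erefl)[n _ /(_ n (leqnn n))] /=.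
rewrite sub0r normrN ger0_norm ?exprn_ge0// ltr_pdivlMr// => rF.
have [Phi [phi [aPhi aphi _ H]]] := superposition_iter f F n cf F0 fF.
by exists Phi, phi; split=> // x cx; rewrite (le_trans (H x cx))// ltW.
Qed.

End Network.

(** * From approximable functions to elements of the span *)

Theorem mainTheorem1 (R : realType) (K : R -> R) (d : nat) :
  continuous K -> ~ is_poly_fun K -> (1 <= d)%N ->
  forall f : 'rV[R]_d -> R, {within @unit_cube R d, continuous f} ->
  forall eps : R, 0 < eps ->
  exists (Phi : 'I_(2 * d + 1) -> R -> R)
         (phi : 'I_d -> 'I_(2 * d + 1) -> R -> R),
    (forall q, in_span_K K (Phi q)) /\
    (forall p q, in_span_K K (phi p q)) /\
    exists M : R, M < eps /\
      forall x, @unit_cube R d x -> `|f x - npkan Phi phi x| <= M.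
Proof.
move=> cK nK _ f cf eps eps0.
have e0 : 0 < eps / 4 by rewrite divr_gt0.
have m0 : 0 < (2 * d + 1)%:R :> R by rewrite ltr0n addn1.
have [Phi [phi [aPhi aphi H]]] := superposition_approx R d K cK nK f (eps / 4) cf e0.
have cPhi q : continuous (Phi q) by have [] := aPhi q.
have cphi p q : continuous (phi p q) by have [] := aphi p q.
(* The inner functions will be replaced within [delta] on [[-1, 1]]; the new inner sums then stay in
   [[-C, C]], where the outer functions are replaced. *)
have [delta delta0 [C [C0 Hdelta]]] := npkan_perturb R d Phi phi (eps / 4) e0 cPhi cphi.
have /choice[psi Hpsi] : forall pq : 'I_d * 'I_(2 * d + 1), exists s, in_span_K K s /\
    forall t, `|t| <= 1 -> `|phi pq.1 pq.2 t - s t| <= delta.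
  by move=> pq; exact: (aphi pq.1 pq.2).2 1 ltr01 delta delta0.
have /choice[Psi HPsi] : forall q : 'I_(2 * d + 1), exists s, in_span_K K s /\
    forall t, `|t| <= C -> `|Phi q t - s t| <= eps / 4 / (2 * d + 1)%:R.
  by move=> q; apply: (aPhi q).2 => //; rewrite divr_gt0.
exists Psi, (fun p q => psi (p, q)); split; first by move=> q; have [] := HPsi q.
split; first by move=> p q; have [] := Hpsi (p, q).
(* The errors of superposition, of the inner replacement and of the outer one. *)
exists (eps / 4 + eps / 4 + eps / 4); split; first by lra.
move=> x cx; set phi' := fun p q => psi (p, q).
have [|inC H1] := Hdelta phi' _ x cx.
  move=> p q t /andP[t0 t1]; rewrite distrC; apply: (Hpsi (p, q)).2.
  by rewrite ger0_norm.
have H2 : `|npkan Phi phi' x - npkan Psi phi' x| <= eps / 4.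
  rewrite /npkan -sumrB (le_trans (ler_norm_sum _ _ _))//.
  apply: (@le_trans _ _ (\sum_(q < 2 * d + 1) eps / 4 / (2 * d + 1)%:R)).
    by apply: ler_sum => q _; apply: (HPsi q).2; exact: inC.
  by rewrite sumr_const card_ord -[X in X <= _]mulr_natr divfK// gt_eqF.
rewrite (_ : _ - _ = (f x - npkan Phi phi x) - (npkan Phi phi' x - npkan Phi phi x)
  + (npkan Phi phi' x - npkan Psi phi' x)); last by ring.
rewrite (le_trans (ler_normD _ _))// lerD// (le_trans (ler_normB _ _))// lerD//.
exact: H.
Qed.
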